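(* Let $\mathbb{E}$ be a real separable Banach space and let $\mu$ be a non-trivial weakly stable distribution on $\mathbb{E}$. If $\lambda\in\mathcal{P}$ is strictly stable with respect to the weak generalized convolution $\oplus_\mu$, then $\mu\circ\lambda$ is a strictly stable distribution on $\mathbb{E}$ (in the classical sense).
   Context: $\mathcal{P}$ is the set of probability measures on $\mathbb{R}$. For a probability measure $\nu$ on a Banach space and $t\in\mathbb{R}$, $T_t\nu$ is the distribution of $tY$, where $Y$ has distribution $\nu$ (so $T_0\nu=\delta_0$). For a probability measure $\mu$ on $\mathbb{E}$ and $\lambda\in\mathcal{P}$, the scale mixture $\mu\circ\lambda$ is the probability measure $\mu\circ\lambda(A)=\int_{\mathbb{R}}T_t\mu(A)\,\lambda(dt)$, i.e. the distribution of $\mathbf{X}\theta$ with $\mathbf{X}\sim\mu$, $\theta\sim\lambda$ independent. A probability measure $\mu$ on $\mathbb{E}$ is weakly stable if for all $a,b\in\mathbb{R}$ there is $\lambda\in\mathcal{P}$ with $T_a\mu * T_b\mu=\mu\circ\lambda$. It is known that this is equivalent to: for all $\lambda_1,\lambda_2\in\mathcal{P}$ there is $\lambda\in\mathcal{P}$ with $(\mu\circ\lambda_1)*(\mu\circ\lambda_2)=\mu\circ\lambda$. The measure $\mu$ is non-trivial if it is not discrete. For non-trivial $\mu$ the measure $\lambda$ is uniquely determined if $\mu$ is not symmetric, and $|\lambda|$ (the distribution of $|\theta|$ for $\theta\sim\lambda$) is uniquely determined if $\mu$ is symmetric. The weak generalized convolution is $\lambda_1\oplus_\mu\lambda_2=\lambda$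 if $\mu$ is not symmetric, and $\lambda_1\oplus_\mu\lambda_2=|\lambda|$ if $\mu$ is symmetric. A measure $\lambda\in\mathcal{P}$ is strictly stable with respect to $\oplus_\mu$ if for all $r,s\ge0$ there exists $c(r,s)\ge0$ such that $(T_r\lambda)\oplus_\mu(T_s\lambda)=(T_{c(r,s)}\lambda)\oplus_\mu\delta_0$; equivalently, $(\mu\circ T_r\lambda)*(\mu\circ T_s\lambda)=\mu\circ T_{c(r,s)}\lambda$. A probability measure $\nu$ on $\mathbb{E}$ is strictly stable (classical sense) if for all $r,s>0$ there is $c>0$ with $T_r\nu*T_s\nu=T_c\nu$ (the degenerate measure $\delta_0$ is allowed). *)

(* Defs.v *)
From HB Require Import structures.
From mathcomp Require Import all_boot all_order all_algebra.
From mathcomp Require Import all_classical all_reals all_analysis.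
From mathcomp Require Import measurable_realfun giry.

Set Implicit Arguments.
Unset Strict Implicit.
Unset Printing Implicit Defensive.

Import Order.TTheory GRing.Theory Num.Theory.
Import numFieldNormedType.Exports.

Local Open Scope classical_set_scope.
Local Open Scope ring_scope.

HB.mixin Record isSeparable (T : Type) & Topological T := {
  separable_subproof : exists2 D : set T, countable D & dense D
}.

#[short(type=separableBanachType)]
HB.structure Definition SeparableBanach (R : realType) :=
  {E of CompleteNormedModule R E & isSeparable E}.

Definition borel (T : ptopologicalType) := g_sigma_algebraType (@open T).

Section measurability.
Context {R : realType}.

Lemma dense_seq (V : normedModType R) :
  (exists2 D : set V, countable D & dense D) ->
  exists u : nat -> V, forall x (e : R), 0 < e -> exists n, ball x e (u n).
Proof.
move=> [D cD dD].
have hD x (e : R) : 0 < e -> exists2 y, D y & ball x e y.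
  move=> e0.
  have [|y [xy Dy]] := dD (ball x e) _ (@ball_open _ _ x e).
    by exists x; exact: ballxx.
  by exists y.
move/pfcard_geP: cD => [D0|[f]].
  by have [y] := hD 0 1 ltr01; rewrite D0.
exists f => x e e0; have [y Dy xy] := hD x e e0.
by have [n _ fny] := 'surj_f Dy; exists n; rewrite fny.
Qed.

Lemma open_prod_bigcup (V W : normedModType R) :
  (exists2 D : set V, countable D & dense D) ->
  (exists2 D : set W, countable D & dense D) ->
  forall U : set (V * W), open U ->
  exists (F : nat * nat * nat -> set V) (G : nat * nat * nat -> set W),
    [/\ forall i, open (F i), forall i, open (G i) &
        U = \bigcup_i (F i `*` G i)].
Proof.
move=> /dense_seq [u hu] /dense_seq [v hv] U oU.
pose F (i : nat * nat * nat) := ball (u i.1.1) (i.2.+1%:R^-1 : R).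
pose G (i : nat * nat * nat) := ball (v i.1.2) (i.2.+1%:R^-1 : R).
pose P i := F i `*` G i `<=` U.
exists (fun i => if `[< P i >] then F i else set0), G; split.
- by move=> i; case: asboolP => _; [exact: ball_open|exact: open0].
- by move=> i; exact: ball_open.
apply/seteqP; split => [[x y] Uxy|[x y] [i _] /=]; last first.
  by case: asboolP => [Pi Fi|_ []//]; exact: Pi.
have : nbhs (x, y) U by exact: open_nbhs_nbhs.
rewrite -nbhs_ballE => -[e /= e0 eU].
have [n _ /(_ n (leqnn n))/= ne] := near_infty_natSinv_lt (PosNum (divr_gt0 e0 (ltr0n R 2))).
have n0 : 0 < n.+1%:R^-1 :> R by rewrite invr_gt0.
have [i xi] := hu x _ n0; have [j yj] := hv y _ n0.
exists (i, j, n) => //=.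
case: asboolP => [_|nP]; first by split => /=; exact: ball_sym.
exfalso; apply: nP => -[a b] [/= Fa Gb]; apply: eU; split => /=.
  rewrite [e]splitr; apply: (ball_triangle (y := u i)).
  - by apply: le_ball xi; exact: ltW.
  - by apply: le_ball Fa; exact: ltW.
rewrite [e]splitr; apply: (ball_triangle (y := v j)).
- by apply: le_ball yj; exact: ltW.
- by apply: le_ball Gb; exact: ltW.
Qed.

Lemma separableR : exists2 D : set R, countable D & dense D.
Proof.
exists (@ratr R @` setT); last exact: dense_rat.
by apply: card_le_trans (card_image_le _ _) _; exact: countableP.
Qed.

End measurability.

Section operations.
Context {R : realType}.

Section dilation_real.
Variable t : R.

Definition real_scale (x : measurableTypeR R) : measurableTypeR R := t * x.

Lemma measurable_real_scale : measurable_fun [set: measurableTypeR R] real_scale.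
Proof. exact: mulrl_measurable. Qed.

HB.instance Definition _ :=
  isMeasurableFun.Build _ _ _ _ real_scale measurable_real_scale.

End dilation_real.

Definition real_abs (x : measurableTypeR R) : measurableTypeR R := `|x|.

Lemma measurable_real_abs : measurable_fun [set: measurableTypeR R] real_abs.
Proof. exact: normr_measurable. Qed.

HB.instance Definition _ :=
  isMeasurableFun.Build _ _ _ _ real_abs measurable_real_abs.

Context {E : separableBanachType R}.

Lemma borel_open (U : set E) : open U -> measurable (U : set (borel E)).
Proof. exact: sub_sigma_algebra. Qed.

Section dilation.
Variable t : R.

Definition borel_scale (x : borel E) : borel E := t *: (x : E).

Lemma measurable_borel_scale : measurable_fun [set: borel E] borel_scale.
Proof.
apply: (@measurability _ _ _ (borel E) _ _ (@open E)) => // _ [U oU <-].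
rewrite setTI; apply: borel_open.
have /continuousP := @scaler_continuous R E t; exact.
Qed.

HB.instance Definition _ :=
  isMeasurableFun.Build _ _ _ _ borel_scale measurable_borel_scale.

End dilation.

Definition borel_add (p : borel E * borel E) : borel E := (p.1 : E) + (p.2 : E).

Lemma measurable_borel_add : measurable_fun [set: borel E * borel E] borel_add.
Proof.
apply: (@measurability _ _ _ (borel E) _ _ (@open E)) => // _ [U oU <-].
have /continuousP cadd : continuous (fun z : E * E => z.1 + z.2).
  exact: add_continuous.
have [F [G [oF oG UE]]] := open_prod_bigcup
  (separable_subproof (s := E)) (separable_subproof (s := E)) (cadd U oU).
rewrite setTI [X in measurable X]UE.
apply: countable_bigcupT_measurable; first exact: countableP.
by move=> i; apply: measurableX; exact: borel_open.
Qed.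

HB.instance Definition _ :=
  isMeasurableFun.Build _ _ _ _ borel_add measurable_borel_add.

Definition borel_mix (p : measurableTypeR R * borel E) : borel E :=
  (p.1 : R) *: (p.2 : E).

Lemma measurable_borel_mix :
  measurable_fun [set: measurableTypeR R * borel E] borel_mix.
Proof.
apply: (@measurability _ _ _ (borel E) _ _ (@open E)) => // _ [U oU <-].
have /continuousP cscale : continuous (fun z : R^o * E => z.1 *: z.2).
  exact: scale_continuous.
have [F [G [oF oG UE]]] := open_prod_bigcup
  (@separableR R) (separable_subproof (s := E)) (cscale U oU).
rewrite setTI [X in measurable X]UE.
apply: countable_bigcupT_measurable; first exact: countableP.
by move=> i; apply: measurableX; [exact: open_measurable|exact: borel_open].
Qed.

HB.instance Definition _ :=
  isMeasurableFun.Build _ _ _ _ borel_mix measurable_borel_mix.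

Definition dilation_real (t : R) (l : probability (measurableTypeR R) R) :
  probability (measurableTypeR R) R := distribution l (real_scale t).

Definition absolute_law (l : probability (measurableTypeR R) R) :
  probability (measurableTypeR R) R := distribution l real_abs.

Definition dilation (t : R) (nu : probability (borel E) R) :
  probability (borel E) R := distribution nu (borel_scale t).

Definition convolution (nu1 nu2 : probability (borel E) R) :
  probability (borel E) R := distribution (nu1 \x nu2)%E borel_add.

(* The law of theta X; the factor l comes first so that the product measure
   unfolds to the integral of [scale_mixtureE]. *)
Definition scale_mixture (mu : probability (borel E) R)
    (l : probability (measurableTypeR R) R) :
  probability (borel E) R := distribution (l \x mu)%E borel_mix.

Lemma scale_mixtureE mu l (A : set (borel E)) :
  scale_mixture mu l A = (\int[l]_t dilation t mu A)%E.
Proof.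
apply: eq_integral => t _ /=.
congr (mu _); apply/seteqP; split => x /=; by rewrite /xsection /= inE.
Qed.

End operations.

Section stability.
Context {R : realType} {E : separableBanachType R}.
Implicit Types (mu nu : probability (borel E) R).
Implicit Types (l : probability (measurableTypeR R) R).

(* Laws are compared by [measure_eq] (i.e. on measurable sets), since the
   values of a [probability] off the sigma-algebra are unconstrained. *)
Definition weakly_stable mu := forall a b : R, exists l,
  convolution (dilation a mu) (dilation b mu) ≡μ scale_mixture mu l.

(* Countable sets are Borel in E. *)
Definition discrete_law mu := exists D : set (borel E), countable D /\ mu D = 1%E.

Definition nontrivial_law mu := ~ discrete_law mu.

Definition symmetric_law mu := dilation (-1) mu ≡μ mu.

(* [weak_gen_conv mu l1 l2 l] is the graph of the partial operation
   (l1, l2) |-> l = l1 (+)_mu l2.  For nontrivial weakly stable mu this graph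
   is that of a total operation: the mixing law l' exists, and l' (resp. its
   absolute law when mu is symmetric) is unique up to [measure_eq]. *)
Definition weak_gen_conv mu l1 l2 l := exists l',
  convolution (scale_mixture mu l1) (scale_mixture mu l2) ≡μ scale_mixture mu l'
  /\ (~ symmetric_law mu -> l ≡μ l')
  /\ (symmetric_law mu -> l ≡μ absolute_law l').

(* Equality of the two values of (+)_mu is expressed by a common value k. *)
Definition gen_strictly_stable mu l := forall r s : R, 0 <= r -> 0 <= s ->
  exists2 c : R, 0 <= c &
    exists k, weak_gen_conv mu (dilation_real r l) (dilation_real s l) k /\
              weak_gen_conv mu (dilation_real c l) \d_(0 : measurableTypeR R) k.

Definition strictly_stable nu := forall r s : R, 0 < r -> 0 < s ->
  exists2 c : R, 0 < c &
    convolution (dilation r nu) (dilation s nu) ≡μ dilation c nu.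

End stability.

(* Main.v *)
(** Unfolding the graph of the generalized convolution, and using
[mu ∘ |l'| = mu ∘ l'] when [mu] is symmetric, strict stability of [l] with
respect to [mu] says that [nu = mu ∘ l] satisfies [T_r nu * T_s nu = T_c nu]
with [c >= 0].  If [c = 0] then [r X + s Y = 0] almost surely for independent
[X, Y] of law [nu]; this forces [nu = δ_0], and then [c = 1] works as well. *)

Require Import Defs.
From mathcomp Require Import all_boot all_order all_algebra.
From mathcomp Require Import all_classical all_reals all_analysis.
From mathcomp Require Import measurable_realfun giry.

Set Implicit Arguments.
Unset Strict Implicit.
Unset Printing Implicit Defensive.

Import Order.TTheory GRing.Theory Num.Theory.
Import numFieldNormedType.Exports.

(* [≡μ] applies the [measure] coercion; this restates it with that of
   [probability], the one produced by writing [P A]. *)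
Lemma measure_eqP d (T : measurableType d) (R : realType) (P Q : probability T R) :
  (P ≡μ Q) <-> (forall A, measurable A -> P A = Q A).
Proof. by []. Qed.

Section laws.
Context {R : realType} {E : separableBanachType R}.
Implicit Types (mu nu : probability (borel E) R).
Implicit Types (l : probability (measurableTypeR R) R).

Local Open Scope classical_set_scope.
Local Open Scope ring_scope.

(** * Scale mixtures under dilation and absolute value *)

Lemma measurable_borel_set1 (x : E) : measurable ([set x] : set (borel E)).
Proof.
rewrite -[X in measurable X]setCK; apply: measurableC.
apply: (@borel_open R E); apply: closed_openC.
exact/accessible_closed_set1/hausdorff_accessible/norm_hausdorff.
Qed.

Lemma xsection_preimage (T1 T2 T : Type) (f : T1 * T2 -> T) (A : set T) x :
  xsection (f @^-1` A) x = [set y | A (f (x, y))].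
Proof. by apply/seteqP; split => y; rewrite /xsection /= inE. Qed.

(** [dilation t mu A] is the [mu]-measure of the section at [t] of the preimage of [A] under
    [borel_mix], so the section half of Tonelli's theorem applies. *)
Lemma measurable_dilationE mu (A : set (borel E)) : measurable A ->
  measurable_fun [set: measurableTypeR R] (fun t : measurableTypeR R => dilation t mu A).
Proof.
move=> mA; rewrite (_ : (fun t => _) = mu \o xsection (@borel_mix R E @^-1` A)).
  apply: measurable_fun_xsection; rewrite -[X in measurable X]setTI.
  exact: measurable_borel_mix.
by apply/funext => t /=; rewrite xsection_preimage.
Qed.

Lemma scale_mixture_distribution mu l (X : {mfun measurableTypeR R >-> measurableTypeR R})
    (A : set (borel E)) : measurable A ->
  scale_mixture mu (distribution l X) A = (\int[l]_t dilation (X t) mu A)%E.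
Proof.
move=> mA; rewrite scale_mixtureE ge0_integral_distribution//.
exact: measurable_dilationE.
Qed.

Lemma scale_mixture_eq mu l1 l2 (A : set (borel E)) : l1 ≡μ l2 -> measurable A ->
  scale_mixture mu l1 A = scale_mixture mu l2 A.
Proof.
move=> /measure_eqP l12 mA; rewrite !scale_mixtureE.
by apply: eq_measure_integral => B mB _; exact: l12.
Qed.

(** Associativity of scaling, [t (u x) = (t u) x], under the mixing integral. *)
Lemma dilation_scale_mixture (t : R) mu l (A : set (borel E)) : measurable A ->
  dilation t (scale_mixture mu l) A = scale_mixture mu (dilation_real t l) A.
Proof.
move=> mA; rewrite [RHS](scale_mixture_distribution mu l (real_scale t) mA).
rewrite [LHS](scale_mixtureE mu l (borel_scale t @^-1` A)).
apply: eq_integral => u _; congr (mu _).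
by apply/seteqP; split => x /=; rewrite /borel_scale scalerA.
Qed.

(** By symmetry of [mu] the integrand [dilation t mu A] depends on [t] only through its absolute
    value. *)
Lemma scale_mixture_absolute_law mu l (A : set (borel E)) :
  symmetric_law mu -> measurable A ->
  scale_mixture mu (absolute_law l) A = scale_mixture mu l A.
Proof.
move=> /measure_eqP symmu mA; rewrite (scale_mixture_distribution mu l real_abs mA) scale_mixtureE.
apply: eq_integral => t _; rewrite -[LHS]/(dilation `|t : R| mu A).
have [_ //|_] := ger0P (t : R).
have mtA : measurable (borel_scale t @^-1` A).
  by rewrite -[X in measurable X]setTI; exact: measurable_borel_scale.
rewrite -[RHS](symmu _ mtA); congr (mu _).
by apply/seteqP; split => x /=; rewrite /borel_scale scalerA mulrN1.
Qed.

(** * Convolution as an integral over translates *)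

Definition borel_translate (x : borel E) (A : set (borel E)) : set (borel E) :=
  [set y | A ((x : E) + (y : E))].

Lemma convolutionE mu nu (A : set (borel E)) :
  convolution mu nu A = (\int[mu]_x nu (borel_translate x A))%E.
Proof. by apply: eq_integral => x _ /=; rewrite xsection_preimage. Qed.

Lemma measurable_borel_translate (x : borel E) (A : set (borel E)) :
  measurable A -> measurable (borel_translate x A).
Proof.
move=> mA; rewrite -[borel_translate x A](xsection_preimage (@borel_add R E) A x).
apply: measurable_xsection; rewrite -[X in measurable X]setTI.
exact: measurable_borel_add.
Qed.

Lemma measurable_fun_borel_translate nu (A : set (borel E)) : measurable A ->
  measurable_fun [set: borel E] (fun x => nu (borel_translate x A)).
Proof.
move=> mA; rewrite (_ : (fun x => _) = nu \o xsection (@borel_add R E @^-1` A)).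
  apply: measurable_fun_xsection; rewrite -[X in measurable X]setTI.
  exact: measurable_borel_add.
by apply/funext => x /=; rewrite xsection_preimage.
Qed.

Lemma convolution_eq mu1 mu2 nu1 nu2 (A : set (borel E)) :
  mu1 ≡μ mu2 -> nu1 ≡μ nu2 -> measurable A ->
  convolution mu1 nu1 A = convolution mu2 nu2 A.
Proof.
move=> /measure_eqP mu12 /measure_eqP nu12 mA; rewrite !convolutionE.
transitivity (\int[mu1]_x nu2 (borel_translate x A))%E.
  by apply: eq_integral => x _; apply: nu12; exact: measurable_borel_translate.
by apply: eq_measure_integral => B mB _; exact: mu12.
Qed.

Lemma dilation0E nu (A : set (borel E)) : dilation 0 nu A = (\1_A (0 : E))%:E.
Proof.
rewrite -[LHS]/(nu (borel_scale 0 @^-1` A)) indicE.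
have [/set_mem A0|/negP A0] := boolP ((0 : E) \in A).
  rewrite (_ : _ @^-1` _ = setT) ?probability_setT//.
  by apply/seteqP; split => y //= _; rewrite /borel_scale scale0r.
rewrite (_ : _ @^-1` _ = set0) ?measure0//.
by apply/seteqP; split => y //=; rewrite /borel_scale scale0r => /mem_set.
Qed.

(** Mixing [mu] with the point mass at 0 gives the point mass at 0 of [E], the neutral element of
    convolution. This removes the right-hand operand [\d_0] in [gen_strictly_stable]. *)
Lemma convolution_scale_mixture_dirac0 mu nu (A : set (borel E)) : measurable A ->
  convolution nu (scale_mixture mu \d_(0 : measurableTypeR R)) A = nu A.
Proof.
move=> mA; rewrite convolutionE.
rewrite (_ : nu A = (\int[nu]_x (\1_A x)%:E)%E); last first.
  by rewrite integral_indic// setIT.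
apply: eq_integral => x _; have mAx := measurable_borel_translate x mA.
rewrite scale_mixtureE integral_dirac//; last exact: measurable_dilationE.
rewrite diracT mul1e dilation0E !indicE; congr ((nat_of_bool _)%:R%:E).
by apply/idP/idP => /set_mem Ax; apply/mem_set; move: Ax;
  rewrite /borel_translate /= addr0.
Qed.

(** * From the generalized to the classical convolution *)

Lemma weak_gen_conv_scale_mixture mu l1 l2 l (A : set (borel E)) :
  weak_gen_conv mu l1 l2 l -> measurable A ->
  convolution (scale_mixture mu l1) (scale_mixture mu l2) A = scale_mixture mu l A.
Proof.
move=> [l' [/measure_eqP mu12 [nsym sym]]] mA; rewrite (mu12 A mA).
have [symmu|/nsym ll'] := pselect (symmetric_law mu).
  by rewrite (scale_mixture_eq _ (sym symmu) mA) scale_mixture_absolute_law.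
by rewrite (scale_mixture_eq _ ll' mA).
Qed.

Lemma gen_strictly_stable_scale_mixture mu l : gen_strictly_stable mu l ->
  forall r s : R, 0 <= r -> 0 <= s -> exists2 c : R, 0 <= c &
    convolution (dilation r (scale_mixture mu l)) (dilation s (scale_mixture mu l))
    ≡μ dilation c (scale_mixture mu l).
Proof.
move=> stabl r s r0 s0; have [c c0 [k [krs kc]]] := stabl r s r0 s0.
have dilE t : dilation t (scale_mixture mu l) ≡μ scale_mixture mu (dilation_real t l).
  by apply/measure_eqP => A; exact: dilation_scale_mixture.
exists c => //; apply/measure_eqP => A mA.
rewrite (convolution_eq (dilE r) (dilE s) mA) (weak_gen_conv_scale_mixture krs mA).
rewrite -(weak_gen_conv_scale_mixture kc mA).
by rewrite convolution_scale_mixture_dirac0// dilation_scale_mixture.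
Qed.

(** * The degenerate case: a sum that vanishes almost surely *)

(** Conditioning on the first summand [x]: the probability that the second one differs from [-x] is
    nonnegative and has integral zero, hence vanishes for almost every [x]. *)
Lemma convolution_dirac0_ae mu nu : convolution mu nu [set (0 : E)] = 1%E ->
  {ae mu, forall x, nu [set - (x : E)] = 1%E}.
Proof.
move=> conv1; have m0 := measurable_borel_set1 0.
have trE (x : borel E) : borel_translate x (~` [set (0 : E)]) = ~` [set - (x : E)].
  apply/seteqP; split => y /= + yx; apply.
    by rewrite yx addrN.
  by apply/eqP; rewrite -addr_eq0 addrC yx.
have : (\int[mu]_x `|nu (borel_translate x (~` [set (0 : E)%R]))| = 0)%E.
  under eq_integral do rewrite gee0_abs//.
  by rewrite -convolutionE probability_setC// conv1 subee.
move=> /ae_eq_integral_abs -/(_ measurableT) [|N [mN N0 subN]].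
  by apply: measurable_fun_borel_translate; exact: measurableC.
exists N; split => // x /= nux1; apply: subN => /= /(_ I).
rewrite trE probability_setC; last exact: measurable_borel_set1.
by move=> /eqP; rewrite sube_eq ?add0e// eq_sym => /eqP.
Qed.

Lemma probability_set1_inj nu (x y : E) :
  nu [set x] = 1%E -> nu [set y] = 1%E -> x = y.
Proof.
move=> nux nuy; apply: contrapT => xy.
have : (nu [set x] <= nu (~` [set y]))%E.
  apply: le_measure; rewrite ?inE; first exact: measurable_borel_set1.
    by apply: measurableC; exact: measurable_borel_set1.
  by move=> z /= ->.
rewrite probability_setC; last exact: measurable_borel_set1.
by rewrite nux nuy subee// lee_fin ler10.
Qed.

Lemma dilation_set1 (t : R) nu (x : E) : 0 < t ->
  dilation t nu [set t *: x] = nu [set x].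
Proof.
move=> t0; congr (nu _); apply/seteqP; split => y /=; last by move=> ->.
by move=> /scalerI -> //; rewrite lt0r_neq0.
Qed.

(** One good value of the first summand already makes [nu] a point mass at some [x]; then
    [r x + s x = 0] with [r + s > 0] forces [x = 0]. *)
Lemma convolution_dilation_dirac0 (r s : R) nu : 0 < r -> 0 < s ->
  convolution (dilation r nu) (dilation s nu) [set (0 : E)] = 1%E ->
  nu [set (0 : E)] = 1%E.
Proof.
move=> r0 s0 /convolution_dirac0_ae ae1.
have [x nux] : exists x : E, nu [set x] = 1%E.
  (* Positive total mass makes the almost-everywhere filter proper, so some [y] satisfies [ae1]: the
     law [dilation s nu] sits at [-y], and [nu] at [-y / s]. *)
  have : (0 < dilation r nu setT)%E by rewrite probability_setT.
  move=> /ae_properfilter_algebraOfSetsType aeF; have [y] := filter_ex ae1.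
  exists (s^-1 *: - (y : E)).
  by rewrite -(@dilation_set1 s)// scalerA mulfV ?scale1r// lt0r_neq0.
(* The point [r x] carries full mass under [dilation r nu], so it cannot lie in the exceptional null
   set. *)
have nurx : dilation s nu [set - (r *: x)] = 1%E.
  apply: contrapT => nurx; case: ae1 => N [mN N0 subN].
  have : (dilation r nu [set r *: x] <= dilation r nu N)%E.
    apply: le_measure; rewrite ?inE//; first exact: measurable_borel_set1.
    by move=> z /= ->; exact: subN.
  by rewrite N0 dilation_set1// nux lee_fin ler10.
have nusx : dilation s nu [set s *: x] = 1%E by rewrite dilation_set1.
have /eqP := probability_set1_inj nurx nusx.
rewrite eq_sym -addr_eq0 -scalerDl scaler_eq0 gt_eqF ?addr_gt0//= => /eqP x0.
by rewrite -x0.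
Qed.

Lemma dilation_dirac0 (t : R) nu (A : set (borel E)) :
  nu [set (0 : E)] = 1%E -> measurable A -> dilation t nu A = dilation 0 nu A.
Proof.
move=> nu0 mA; rewrite dilation0E indicE.
have mtA : measurable (borel_scale t @^-1` A).
  by rewrite -[X in measurable X]setTI; exact: measurable_borel_scale.
have [/set_mem A0|/negP A0] := boolP ((0 : E) \in A).
  apply/eqP; rewrite eq_le probability_le1//= -nu0.
  apply: le_measure; rewrite ?inE//; first exact: measurable_borel_set1.
  by move=> y /= ->; rewrite /borel_scale scaler0.
apply/eqP; rewrite -measure_le0.
(* As 0 is not in [A], the preimage of [A] under scaling avoids 0 and so lies in a null set. *)
rewrite -[leRHS](_ : nu (~` [set (0 : E)]) = 0%E); last first.
  by rewrite probability_setC ?nu0 ?subee//; exact: measurable_borel_set1.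
rewrite -[leLHS]/(nu (borel_scale t @^-1` A)).
apply: le_measure; rewrite ?inE//; first exact: (measurableC (measurable_borel_set1 0)).
move=> y /= Aty y0; apply: A0; apply/mem_set; move: Aty.
by rewrite y0 /borel_scale scaler0.
Qed.

End laws.

Theorem theorem2 (R : realType) (E : separableBanachType R)
  (mu : probability (borel E) R) (l : probability (measurableTypeR R) R) :
  nontrivial_law mu -> weakly_stable mu -> gen_strictly_stable mu l ->
  strictly_stable (scale_mixture mu l).
Proof.
move=> _ _ stabl r s r0 s0.
have [c] := gen_strictly_stable_scale_mixture stabl (ltW r0) (ltW s0).
rewrite le0r => /orP[/eqP ->|c0] conv; last by exists c.
move/measure_eqP in conv.
(* Here [c = 0]. Any positive constant would serve, since all dilations of the point mass at 0
   agree; that [nu] is this mass follows by evaluating [conv] at the singleton of 0. *)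
exists 1%R => //; apply/measure_eqP => A mA; rewrite (conv A mA); symmetry; apply: dilation_dirac0 => //.
apply: (convolution_dilation_dirac0 r0 s0).
rewrite conv; last exact: measurable_borel_set1.
by rewrite dilation0E indicE mem_set.
Qed.
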